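(* If $\mathcal L_{\phi,x}$ satisfies Hörmander's condition, then $\mathcal L_\phi$ also satisfies it. Conversely, suppose that $\mathcal L_\phi$ satisfies Hörmander's condition and that there exist fields $\tilde T^1J,\dots,\tilde T^nJ$ of the form $\tilde T^iJ=\sum_{|\alpha|\ge1}c^i_\alpha\,\mathbb G^\alpha J$ (finite sums over multi-indices $\alpha\in\mathbb N^k$ with real coefficients $c^i_\alpha$), $i=1,\dots,n$, such that $\tilde T^1J(\phi),\dots,\tilde T^nJ(\phi)$ are linearly independent for every $\phi\in(0,\infty)^n$. Then $\mathcal L_{\phi,x}$ satisfies Hörmander's condition.
   Context: Let $1\le k<n$ be integers. Let $Q=(q_{ij})_{i,j=0}^n$ be a real matrix with $q_{ij}\ge0$ for $i\ne j$, $q_{ii}\le0$, and $\sum_{j=0}^nq_{ij}=0$ for every $i$. Let $\lambda_0,\dots,\lambda_n\in\mathbb R^k$ be pairwise distinct, with $\lambda_0$ a vertex of their convex hull; write $\lambda_{ir}$ for the $r$-th component of $\lambda_i$. Put $a_i:=\lambda_i-\lambda_0$, with components $a_{ir}$ ($1\le r\le k$), and $\Sigma_{ij}:=a_i\cdot a_j$. For $\phi\in(0,\infty)^n$ let $\phi_0:=1$ and $y(\phi):=1+\sum_{i=1}^n\phi_i$. Define vector fields on $(0,\infty)^n$: $$D_r=\sum_{j=1}^na_{jr}\phi_j\,\partial_{\phi_j}\ (1\le r\le k),\qquad D_0=\sum_{j=1}^n\Big(\frac1{y(\phi)}\sum_{i=1}^n\Sigma_{ij}\phi_i\phi_j-\frac12\|a_j\|^2\phi_j\Big)\partial_{\phi_j},$$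 $$J=\sum_{j=1}^n\sum_{i=0}^n(q_{ij}-q_{i0}\phi_j)\phi_i\,\partial_{\phi_j},\qquad D_0^J=D_0+J,\qquad \mathcal L_\phi=D_0^J+\frac12\sum_{r=1}^kD_r^2.$$ On $(0,\infty)^n\times\mathbb R^k$ (coordinates $(\phi,x)$) define $$\tilde\lambda_r(\phi)=\frac1{y(\phi)}\Big(\lambda_{0r}+\sum_{i=1}^n\lambda_{ir}\phi_i\Big),\quad \tilde D_r=D_r+\partial_{x_r},\quad \hat D_0=D_0^J+\sum_{r=1}^k\tilde\lambda_r(\phi)\,\partial_{x_r},\quad \mathcal L_{\phi,x}=\hat D_0+\frac12\sum_{r=1}^k\tilde D_r^2.$$ Lie bracket: $[F,G]=FG-GF$; $\operatorname{ad}_{D_r}U=[D_r,U]$; for a multi-index $\alpha=(\alpha_1,\dots,\alpha_k)$ of nonnegative integers, $|\alpha|=\sum_r\alpha_r$ and $\mathbb G^\alpha U=\operatorname{ad}_{D_1}^{\alpha_1}\cdots\operatorname{ad}_{D_k}^{\alpha_k}U$. An operator $F_0+\frac12\sum_{r=1}^kF_r^2$ satisfies Hörmander's condition if at every point of its domain the values of $F_0,\dots,F_k$ and of all their iterated Lie brackets span the whole tangent space ($\mathbb R^n$ for $\mathcal L_\phi$, $\mathbb R^{n+k}$ for $\mathcal L_{\phi,x}$). *)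

(* Defs.v *)
From HB Require Import structures.
From mathcomp Require Import all_boot all_order all_algebra.
From mathcomp Require Import all_classical all_reals all_analysis.

Set Implicit Arguments.
Unset Strict Implicit.
Unset Printing Implicit Defensive.

Import Order.TTheory GRing.Theory Num.Theory.
Import numFieldNormedType.Exports.

Local Open Scope classical_set_scope.
Local Open Scope ring_scope.

Section VectorFields.
Context {R : realType} {m : nat}.

(* The field \sum_j F^j \partial_j is encoded by its row of coefficients F^j. *)
Definition vfield := 'rV[R]_m -> 'rV[R]_m.

Definition act (F : vfield) (f : 'rV[R]_m -> R) : 'rV[R]_m -> R :=
  fun p => 'D_(F p) f p.

(* [F, G] = F G - G F: the j-th coefficient of a field is its value on the
   j-th coordinate function u_j, and G u_j = G^j. *)
Definition lie (F G : vfield) : vfield :=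
  fun p => \row_j (act F (fun q => G q 0 j) p - act G (fun q => F q 0 j) p).

Inductive iter_brackets (S : set vfield) : vfield -> Prop :=
| ib_gen F of S F : iter_brackets S F
| ib_lie F G of iter_brackets S F & iter_brackets S G :
    iter_brackets S (lie F G).

Definition spans_all (A : set 'rV[R]_m) : Prop :=
  forall v, exists2 X : seq 'rV[R]_m,
    (forall x, x \in X -> A x) & v \in <<X>>%VS.

(* Hoermander's condition on the open set dom for
   F0 + 1/2 \sum_r (F r)^2. *)
Definition hormander (k : nat) (dom : set 'rV[R]_m)
    (F0 : vfield) (F : 'I_k -> vfield) : Prop :=
  forall p, dom p ->
    spans_all [set G p | G in iter_brackets ([set F0] `|` range F)].

(* ad_{D_1}^{alpha_1} ... ad_{D_k}^{alpha_k} U *)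
Definition ad_multi (k : nat) (D : 'I_k -> vfield)
    (alpha : {ffun 'I_k -> nat}) (U : vfield) : vfield :=
  foldr (fun r V => iter (alpha r) (lie (D r)) V) U (enum 'I_k).

End VectorFields.
Arguments vfield R m : clear implicits.

Section ConvexHull.
Context {R : realType} {k : nat}.

Definition convex_hull (I : finType) (v : I -> 'rV[R]_k) : set 'rV[R]_k :=
  [set x | exists w : I -> R,
    [/\ forall i, 0 <= w i, \sum_i w i = 1 & x = \sum_i w i *: v i]].

(* The vertices of a polytope are its extreme points. *)
Definition extreme_point (A : set 'rV[R]_k) (p : 'rV[R]_k) : Prop :=
  A p /\ forall x y t, A x -> A y -> 0 < t < 1 ->
    p = t *: x + (1 - t) *: y -> x = p /\ y = p.

End ConvexHull.

(* The index 0 is ord0 : 'I_n.+1 and an index 1 <= j <= n is lift ord0 j with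
   j : 'I_n; so the coordinates (phi_1, ..., phi_n) form a row in 'rV_n. *)
Section Model.
Context {R : realType} {n k : nat}.
Variables (Q : 'M[R]_n.+1) (lambda : 'I_n.+1 -> 'rV[R]_k).

Definition orthant : set 'rV[R]_n := [set phi | forall j, 0 < phi 0 j].

Definition orthant_x : set 'rV[R]_(n + k) := [set z | orthant (lsubmx z)].

Definition phi_ (phi : 'rV[R]_n) (i : 'I_n.+1) : R :=
  if unlift ord0 i is Some j then phi 0 j else 1.

Definition y_ (phi : 'rV[R]_n) : R := 1 + \sum_i phi 0 i.

Definition a_ (j : 'I_n) : 'rV[R]_k := lambda (lift ord0 j) - lambda ord0.

Definition Sigma (i j : 'I_n) : R := \sum_r a_ i 0 r * a_ j 0 r.

Definition D_ (r : 'I_k) : vfield R n := fun phi => \row_j (a_ j 0 r * phi 0 j).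

(* Sigma j j is the squared Euclidean norm of a_j. *)
Definition D0 : vfield R n := fun phi =>
  \row_j ((y_ phi)^-1 * (\sum_i Sigma i j * phi 0 i * phi 0 j)
          - 2^-1 * Sigma j j * phi 0 j).

Definition J : vfield R n := fun phi =>
  \row_j \sum_i (Q i (lift ord0 j) - Q i ord0 * phi 0 j) * phi_ phi i.

Definition D0J : vfield R n := fun phi => D0 phi + J phi.

Definition lambda_tilde (phi : 'rV[R]_n) : 'rV[R]_k :=
  \row_r ((y_ phi)^-1 *
    (lambda ord0 0 r + \sum_i lambda (lift ord0 i) 0 r * phi 0 i)).

(* A point (phi, x) is row_mx phi x. *)
Definition D_tilde (r : 'I_k) : vfield R (n + k) :=
  fun z => row_mx (D_ r (lsubmx z)) (delta_mx 0 r).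

Definition D0_hat : vfield R (n + k) :=
  fun z => row_mx (D0J (lsubmx z)) (lambda_tilde (lsubmx z)).

Definition TJ (s : seq {ffun 'I_k -> nat}) (c : {ffun 'I_k -> nat} -> R) :
    vfield R n :=
  fun phi => \sum_(alpha <- s) c alpha *: ad_multi D_ alpha J phi.

End Model.
Arguments orthant R n : clear implicits.
Arguments orthant_x R n k : clear implicits.

(* Main.v *)
(** The fields D~_r and D^_0 do not depend on x, so every iterated bracket of
    them projects to the corresponding bracket of the D_r and D_0^J; spanning
    R^(n+k) therefore forces spanning R^n.  Conversely D_0 is
    \sum_s (lambda~_s - lambda_0s) D_s plus a diagonal linear field, and both
    that field and the D_s commute with every D_r; hence, for |alpha| >= 1,
    G^alpha D^_0 equals (G^alpha J, 0) modulo combinations of the generators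
    D~_s.  So the span of the brackets contains (T^i J, 0), i.e. R^n x {0}, and
    the D~_s supply the remaining k directions. *)
Require Import Defs.
From HB Require Import structures.
From mathcomp Require Import all_boot all_order all_algebra.
From mathcomp Require Import all_classical all_reals all_analysis.
From mathcomp Require Import ring.

Set Implicit Arguments.
Unset Strict Implicit.

Import Order.TTheory GRing.Theory Num.Theory.
Import numFieldNormedType.Exports.
Local Open Scope classical_set_scope.
Local Open Scope ring_scope.

(** * Directional derivatives and openness of the orthant *)

Lemma derive_lsubmx (R : realType) (n k : nat) (f : 'rV[R]_n -> R)
    (z v : 'rV[R]_(n + k)) :
  'D_v (fun w => f (lsubmx w)) z = 'D_(lsubmx v) f (lsubmx z).
Proof.
rewrite /derive; set u := fun h => _; set w := fun h => _.
suff -> : u = w by [].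
apply/funext => h; rewrite /u /w /=.
(* By linearity of [lsubmx] both difference quotients are the same function, so [f] may be
   arbitrary. *)
by rewrite linearP.
Qed.

Lemma is_derive_coord (R : realType) (n : nat) (p v : 'rV[R]_n) (j : 'I_n) :
  is_derive p v (fun q : 'rV[R]_n => q 0 j) (v 0 j).
Proof.
have E : \forall h \near (0 : R)^',
    h^-1 *: (((fun q : 'rV[R]_n => q 0 j) \o shift p) (h *: v) - p 0 j) = v 0 j.
  near=> h.
  have h0 : h != 0 by near: h; exact: nbhs_dnbhs_neq.
  by rewrite /= !mxE addrK scalerA mulVf // scale1r.
split; first exact: (is_cvg_near_cst (v 0 j)).
exact: lim_near_cst.
Unshelve. all: by end_near. Qed.

(** A finite intersection of open half-spaces. Openness lets functions known only on the orthant be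
    differentiated there. *)
Lemma near_orthant (R : realType) (n : nat) (p : 'rV[R]_n) :
  orthant R n p -> \forall q \near p, orthant R n q.
Proof.
move=> p_gt0.
apply: (@filter_forall _ _ (fun j (q : 'rV[R]_n) => is_true (0 < q 0 j)) _
  (nbhs_filter p)) => j.
apply: (@coord_continuous R 1 n 0 j p [set x | 0 < x]).
exact: lt_nbhsr.
Qed.

Lemma near_orthant_x (R : realType) (n k : nat) (z : 'rV[R]_(n + k)) :
  orthant_x R n k z -> \forall w \near z, orthant_x R n k w.
Proof. by move=> /near_orthant; apply: continuous_lsubmx. Qed.

(* The coefficients of all the fields at hand, up to equality on the
   orthant; unlike differentiability, this class is stable under the D_r. *)
Inductive regular {R : realType} {n : nat} : ('rV[R]_n -> R) -> Prop :=
| reg_cst c : regular (fun=> c)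
| reg_coord j : regular (fun p => p 0 j)
| reg_yV : regular (fun p => (y_ p)^-1)
| reg_add f g : regular f -> regular g -> regular (fun p => f p + g p)
| reg_mul f g : regular f -> regular g -> regular (fun p => f p * g p)
| reg_ext f g : regular f -> (forall p, orthant R n p -> f p = g p) -> regular g.

(** * Regular coefficients and their derivatives along [D_ lambda r] *)

Section Regular.
Context {R : realType} {n k : nat}.
Implicit Types f : 'rV[R]_n -> R.

Lemma reg_sum (I : Type) (s : seq I) (F : I -> 'rV[R]_n -> R) :
  (forall i, regular (F i)) -> regular (fun p => \sum_(i <- s) F i p).
Proof.
move=> rF; elim: s => [|i s IHs].
  by apply: reg_ext (reg_cst 0) _ => p _; rewrite big_nil.
by apply: reg_ext (reg_add (rF i) IHs) _ => p _; rewrite big_cons.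
Qed.

Lemma y_gt0 (p : 'rV[R]_n) : orthant R n p -> 0 < y_ p.
Proof.
by move=> p0; rewrite ltr_wpDr ?ltr01 // sumr_ge0 // => i _; exact/ltW/p0.
Qed.

Variable lambda : 'I_n.+1 -> 'rV[R]_k.
Implicit Type r : 'I_k.

(** Existence of the derivative together with regularity of its value keeps iterated brackets inside
    the class. *)
Lemma regular_derive r f : regular f ->
  exists2 g, regular g &
    forall p, orthant R n p -> is_derive p (D_ lambda r p) f (g p).
Proof.
elim=> {f} [c|j||f g _ [f' rf' Df] _ [g' rg' Dg]
  |f g rf [f' rf' Df] rg [g' rg' Dg]|f g _ [f' rf' Df] fg].
- by exists (fun=> 0); [exact: reg_cst|move=> p _; exact: is_derive_cst].
- exists (fun p => a_ lambda j 0 r * p 0 j).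
    by apply: reg_mul; [exact: reg_cst|exact: reg_coord].
  move=> p _; apply: is_derive_eq; first exact: is_derive_coord.
  by rewrite mxE.
(* Chain rule for the inverse of [y_]: minus its inverse square times the derivative of [y_] along
   [D_ lambda r]. *)
- exists (fun p => (- 1 * ((y_ p)^-1 * (y_ p)^-1)) * \sum_i (a_ lambda i 0 r * p 0 i)).
    apply: reg_mul; last first.
      by apply: reg_sum => i; apply: reg_mul; [exact: reg_cst|exact: reg_coord].
    by apply: reg_mul; [exact: reg_cst|apply: reg_mul; exact: reg_yV].
  move=> p p0.
  have Dy : is_derive p (D_ lambda r p) y_ (\sum_i (a_ lambda i 0 r * p 0 i)).
    have -> : y_ = (cst 1 + \sum_(i < n) (fun q : 'rV[R]_n => q 0 i)).
      by apply/funext => q; rewrite /y_ !fctE fct_sumE.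
    apply: is_derive_eq.
      apply: is_deriveD; apply: is_derive_sum => i; exact: is_derive_coord.
    by rewrite add0r; apply: eq_bigr => i _; rewrite mxE.
  have y0 : y_ p != 0 by rewrite gt_eqF // y_gt0.
  split; first exact: derivableV.
  rewrite deriveV // derive_val; congr (_ * _).
  by rewrite mulN1r -expr2 exprVn.
- exists (fun p => f' p + g' p); first exact: reg_add.
  by move=> p p0; have ? := Df p p0; have ? := Dg p p0; exact: is_deriveD.
- exists (fun p => f p * g' p + g p * f' p).
    by apply: reg_add; exact: reg_mul.
  by move=> p p0; have ? := Df p p0; have ? := Dg p p0; exact: is_deriveM.
- exists f' => // p p0; apply: near_eq_is_derive (Df p p0).
  by apply: filterS (near_orthant p0) => q; exact: fg.
Qed.

Lemma is_derive_regular {r f p} : regular f -> orthant R n p ->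
  is_derive p (D_ lambda r p) f (act (D_ lambda r) f p).
Proof.
by move=> /(regular_derive r)[g _ Dg] /Dg Dp; apply: (is_derive_eq Dp); rewrite /act derive_val.
Qed.

Lemma act_regular {r f} : regular f -> regular (act (D_ lambda r) f).
Proof.
move=> /(regular_derive r)[g rg Dg]; apply: reg_ext rg _ => p /Dg Dp.
by rewrite /act derive_val.
Qed.

(** * Brackets with [D_ lambda r] and [D_tilde lambda r] *)

Lemma act_D_tilde r f (h : 'rV[R]_(n + k) -> R) z :
  (forall w, orthant_x R n k w -> h w = f (lsubmx w)) -> orthant_x R n k z ->
  act (D_tilde lambda r) h z = act (D_ lambda r) f (lsubmx z).
Proof.
move=> hf z0; rewrite /act.
rewrite (@near_eq_derive _ _ _ h (fun w => f (lsubmx w))); last first.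
  by apply: filterS (near_orthant_x z0) => w; exact: hf.
by rewrite derive_lsubmx row_mxKl.
Qed.

Lemma act_D_coord (F : vfield R n) r j p :
  act F (fun q => D_ lambda r q 0 j) p = a_ lambda j 0 r * F p 0 j.
Proof.
have -> : (fun q => D_ lambda r q 0 j) =
    (a_ lambda j 0 r \*: (fun q : 'rV[R]_n => q 0 j)).
  by apply/funext => q; rewrite mxE.
have ? := is_derive_coord p (F p) j.
by rewrite /act derive_val.
Qed.

Lemma lie_DE r (V : vfield R n) p j : lie (D_ lambda r) V p 0 j =
  act (D_ lambda r) (fun q => V q 0 j) p - a_ lambda j 0 r * V p 0 j.
Proof. by rewrite mxE act_D_coord. Qed.

Lemma regular_lie r (V : vfield R n) : (forall j, regular (fun p => V p 0 j)) ->
  forall j, regular (fun p => lie (D_ lambda r) V p 0 j).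
Proof.
move=> rV j; apply: (@reg_ext _ _ (fun p => act (D_ lambda r)
  (fun q => V q 0 j) p + (- a_ lambda j 0 r) * V p 0 j)).
  apply: reg_add; first exact: act_regular.
  by apply: reg_mul; [exact: reg_cst|].
by move=> p _; rewrite lie_DE mulNr.
Qed.

Lemma lie_D_tilde_lshift r (H : vfield R (n + k)) z j :
  lie (D_tilde lambda r) H z 0 (lshift k j) =
  act (D_tilde lambda r) (fun w => H w 0 (lshift k j)) z
  - a_ lambda j 0 r * H z 0 (lshift k j).
Proof.
rewrite mxE; congr (_ - _).
have -> : (fun q => D_tilde lambda r q 0 (lshift k j)) =
    (fun q => D_ lambda r (lsubmx q) 0 j).
  by apply/funext => q; rewrite row_mxEl.
rewrite /act (derive_lsubmx (fun q => D_ lambda r q 0 j)).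
(* Only the value [H z] matters, so it is frozen into a constant field on R^n, where [act_D_coord]
   applies. *)
rewrite -[LHS]/(act (fun=> lsubmx (H z)) _ (lsubmx z)) act_D_coord.
by congr (_ * _); rewrite mxE.
Qed.

Lemma lie_D_tilde_rshift r (H : vfield R (n + k)) z s :
  lie (D_tilde lambda r) H z 0 (rshift n s) =
  act (D_tilde lambda r) (fun w => H w 0 (rshift n s)) z.
Proof.
rewrite mxE [X in _ - X](_ : _ = 0) ?subr0 // /act.
have -> : (fun q => D_tilde lambda r q 0 (rshift n s)) =
    cst ((delta_mx 0 r : 'rV[R]_k) 0 s).
  by apply/funext => q; rewrite row_mxEr.
exact: derive_cst.
Qed.

(** [D_ lambda r] commutes with the diagonal linear field and with each [D_ lambda s], so the
    Leibniz rule leaves only the derivatives of the [g s]. *)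
Lemma lie_D_lift r (d : 'I_n -> R) (g : 'I_k -> 'rV[R]_n -> R) (V : vfield R n) p :
  (forall s, regular (g s)) -> (forall j, regular (fun q => V q 0 j)) ->
  orthant R n p ->
  lie (D_ lambda r) (fun q => V q + \row_j (d j * q 0 j)
                            + \sum_s g s q *: D_ lambda s q) p =
  lie (D_ lambda r) V p + \sum_s act (D_ lambda r) (g s) p *: D_ lambda s p.
Proof.
move=> rg rV p0.
have DE s q j : D_ lambda s q 0 j = a_ lambda j 0 s * q 0 j by rewrite mxE.
have rowE (h : 'I_n -> R) j : (\row_i h i : 'rV[R]_n) 0 j = h j by rewrite mxE.
have sumE (c : 'I_k -> R) q j : (\sum_s c s *: D_ lambda s q) 0 j =
    \sum_s c s * (a_ lambda j 0 s * q 0 j).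
  by rewrite summxE; apply: eq_bigr => s _; rewrite -DE mxE.
have addE (u v : 'rV[R]_n) j : (u + v) 0 j = u 0 j + v 0 j by rewrite mxE.
apply/rowP => j; rewrite addE !lie_DE !addE rowE !sumE.
have -> : (fun q => (V q + \row_i (d i * q 0 i)
     + \sum_s g s q *: D_ lambda s q) 0 j) =
     (fun q => V q 0 j) + (d j \*: (fun q : 'rV[R]_n => q 0 j)) +
     \sum_(s < k) (g s * (a_ lambda j 0 s \*: (fun q : 'rV[R]_n => q 0 j))).
  apply/funext => q; rewrite !addE rowE sumE !fctE fct_sumE.
  by congr (_ + _); apply: eq_bigr.
have DV := @is_derive_regular r _ p (rV j) p0.
have Dg s := @is_derive_regular r _ p (rg s) p0.
have Dc := is_derive_coord p (D_ lambda r p) j.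
rewrite {1}/act derive_val DE.
(* Of the two sums given by Leibniz, the second cancels against the [a_ lambda j 0 r] term of
   [lie_DE]. *)
rewrite [X in _ + X - _ = _](_ : _ =
    \sum_s act (D_ lambda r) (g s) p * (a_ lambda j 0 s * p 0 j)
    + a_ lambda j 0 r * \sum_s g s p * (a_ lambda j 0 s * p 0 j)); last first.
  rewrite mulr_sumr -big_split; apply: eq_bigr => s _ /=.
  by rewrite /GRing.scale /=; ring.
by rewrite /GRing.scale /=; ring.
Qed.

(* The bracket by D~_r turns V + \sum_j d_j phi_j d/dphi_j + \sum_s g_s D~_s
   into [D_r, V] + \sum_s (D_r g_s) D~_s: it kills the diagonal linear part,
   and the D~_s commute with each other.  The flag [b] records that d = 0. *)
Definition lifts (b : bool) (H : vfield R (n + k)) (V : vfield R n) : Prop :=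
  exists (d : 'I_n -> R) (g : 'I_k -> 'rV[R]_n -> R),
  [/\ b -> forall j, d j = 0, forall s, regular (g s),
      forall j, regular (fun p => V p 0 j)
    & forall z, orthant_x R n k z -> let p := lsubmx z in
      H z = row_mx (V p + \row_j (d j * p 0 j) + \sum_s g s p *: D_ lambda s p)
                   (\row_s g s p)].

Lemma lifts_lie r b H V : lifts b H V ->
  lifts true (lie (D_tilde lambda r) H) (lie (D_ lambda r) V).
Proof.
move=> [d [g [_ rg rV HE]]]; exists (fun=> 0), (fun s => act (D_ lambda r) (g s)).
split => // [s|j|z z0 p]; [exact: act_regular|exact: regular_lie|].
have p0 : orthant R n p by [].
apply/rowP => i; case: (split_ordP i) => [j|s] ->.
  rewrite lie_D_tilde_lshift HE // !row_mxEl -/p.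
  rewrite (@act_D_tilde _ (fun q => (V q + \row_i (d i * q 0 i)
     + \sum_s g s q *: D_ lambda s q) 0 j)) //; last first.
    by move=> w w0; rewrite HE // row_mxEl.
  rewrite -lie_DE lie_D_lift // -/p; congr (fun_of_matrix _ 0 j); congr (_ + _).
  rewrite [\row_i _](_ : _ = 0) ?addr0 //.
  by apply/rowP => i'; rewrite !mxE mul0r.
rewrite lie_D_tilde_rshift row_mxEr mxE; apply: act_D_tilde => // w w0.
by rewrite HE // row_mxEr mxE.
Qed.

Lemma lifts_ad_multi (alpha : {ffun 'I_k -> nat}) H V : lifts false H V ->
  (1 <= \sum_r alpha r)%N ->
  lifts true (ad_multi (D_tilde lambda) alpha H) (ad_multi (D_ lambda) alpha V).
Proof.
move=> HV alpha_gt0; rewrite /ad_multi.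
(* The flag now recurses along the enumeration: a zero exponent leaves it unchanged, a positive one
   sets it. *)
have -> : true = has (fun r => 0 < alpha r)%N (enum 'I_k).
  apply/esym/hasP; apply: contrapT => no; move: alpha_gt0.
  rewrite big1 // => r _; apply/eqP; rewrite -leqn0 leqNgt; apply/negP => r0.
  by apply: no; exists r; rewrite ?mem_enum.
elim: (enum _) => //= r l IHl.
case: (alpha r) => //= m; elim: m => [|m IHm]; apply: lifts_lie; [exact: IHl|exact: IHm].
Qed.

End Regular.

(** * Regularity of the model coefficients and decomposition of [D0_hat] *)

Section Model.
Context {R : realType} {n k : nat}.
Variables (Q : 'M[R]_n.+1) (lambda : 'I_n.+1 -> 'rV[R]_k).

Lemma regular_J j : regular (fun p => J Q p 0 j).
Proof.
apply: (@reg_ext _ _ (fun p : 'rV[R]_n => \sum_i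
  (Q i (lift ord0 j) + (- Q i ord0) * p 0 j) * phi_ p i)); last first.
  by move=> p _; rewrite mxE; apply: eq_bigr => i _; rewrite mulNr.
apply: reg_sum => i; apply: reg_mul.
  apply: reg_add; first exact: reg_cst.
  by apply: reg_mul; [exact: reg_cst|exact: reg_coord].
by rewrite /phi_; case: (unlift ord0 i) => [l|]; [exact: reg_coord|exact: reg_cst].
Qed.

Lemma regular_lambda_tilde r : regular (fun p : 'rV[R]_n => lambda_tilde lambda p 0 r).
Proof.
apply: (@reg_ext _ _ (fun p : 'rV[R]_n => (y_ p)^-1 *
    (lambda ord0 0 r + \sum_i lambda (lift ord0 i) 0 r * p 0 i))); last first.
  by move=> p _; rewrite mxE.
apply: reg_mul; first exact: reg_yV.
apply: reg_add; first exact: reg_cst.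
by apply: reg_sum => i; apply: reg_mul; [exact: reg_cst|exact: reg_coord].
Qed.

(* D_0 = \sum_s (lambda~_s - lambda_0s) D_s - 1/2 \sum_j |a_j|^2 phi_j d/dphi_j *)
Lemma lifts_D0_hat : lifts lambda false (D0_hat Q lambda) (J Q).
Proof.
(* The multipliers are [lambda_tilde] itself, to match the x-components, so the shift by
   [lambda ord0] moves into the diagonal part. *)
exists (fun j => - (2^-1 * Sigma lambda j j)
          - \sum_s lambda ord0 0 s * a_ lambda j 0 s),
  (fun s p => lambda_tilde lambda p 0 s).
split=> // [s|j|z z0 p]; [exact: regular_lambda_tilde|exact: regular_J|].
congr row_mx; last by apply/rowP => s; rewrite [RHS]mxE.
have y0 : y_ p != 0 by rewrite gt_eqF // y_gt0.
rewrite /D0J -/p; clearbody p => {z z0}.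
have addE (u v : 'rV[R]_n) j : (u + v) 0 j = u 0 j + v 0 j by rewrite mxE.
apply/rowP => j; rewrite !addE addrC -[RHS]addrA; congr (_ + _).
rewrite [D0 _ _ _ _]mxE [(\row_i _) _ _]mxE summxE.
have -> : \sum_s (lambda_tilde lambda p 0 s *: D_ lambda s p) 0 j =
    (y_ p)^-1 * (\sum_i Sigma lambda i j * p 0 i * p 0 j)
    + (\sum_s lambda ord0 0 s * a_ lambda j 0 s) * p 0 j.
  have -> : \sum_i Sigma lambda i j * p 0 i * p 0 j =
      \sum_s (\sum_i a_ lambda i 0 s * p 0 i) * (a_ lambda j 0 s * p 0 j).
    under [RHS]eq_bigr do rewrite mulr_suml.
    rewrite exchange_big; apply: eq_bigr => i _; rewrite /Sigma !mulr_suml.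
    by apply: eq_bigr => s _; ring.
  rewrite mulr_sumr mulr_suml -big_split; apply: eq_bigr => s _; rewrite !mxE.
  (* Since [y_ p - 1] is the sum of the coordinates, this is the numerator of [lambda_tilde] minus
     [y_ p] times [lambda ord0 0 s]. *)
  have -> : \sum_i a_ lambda i 0 s * p 0 i =
      \sum_i lambda (lift ord0 i) 0 s * p 0 i - lambda ord0 0 s * (y_ p - 1).
    rewrite /y_ addrAC subrr add0r mulr_sumr -sumrB.
    by apply: eq_bigr => i _; rewrite !mxE; ring.
  by rewrite /GRing.scale /=; field.
ring.
Qed.

(** * Iterated brackets and Hörmander's condition *)

Lemma iter_brackets_ad_multi (m : nat) (S : set (vfield R m))
    (D : 'I_k -> vfield R m) alpha U :
  (forall r, S (D r)) -> S U -> iter_brackets S (ad_multi D alpha U).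
Proof.
move=> SD SU; rewrite /ad_multi.
elim: (enum _) => [|r l IHl] /=; first exact: ib_gen.
by elim: (alpha r) => //= m' IH; apply: ib_lie => //; apply: ib_gen.
Qed.

(** A function of phi is differentiated only along the left block of a field, so independence of x
    survives brackets; [h] merely records that the x-part depends on phi alone. *)
Lemma iter_brackets_tilde_lsubmx (H : vfield R (n + k)) :
  iter_brackets ([set D0_hat Q lambda] `|` range (D_tilde lambda)) H ->
  exists G h, iter_brackets ([set D0J Q lambda] `|` range (D_ lambda)) G /\
    H = fun z => row_mx (G (lsubmx z)) (h (lsubmx z)).
Proof.
elim=> {H} [_ [->|[r _ <-]]|_ _ _ [F [f [iF ->]]] _ [G [g [iG ->]]]].
- exists (D0J Q lambda), (lambda_tilde lambda); split => //.
  by apply: ib_gen; left.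
- exists (D_ lambda r), (fun=> delta_mx 0 r); split => //.
  by apply: ib_gen; right; exists r.
exists (lie F G), (fun p => \row_s (act F (fun q => g q 0 s) p
                            - act G (fun q => f q 0 s) p)).
split; first exact: ib_lie.
have actl (A : vfield R n) a (U : 'rV[R]_n -> R) z : act (fun w : 'rV[R]_(n + k) =>
    row_mx (A (lsubmx w)) (a (lsubmx w)) : 'rV[R]_(n + k))
    (fun w => U (lsubmx w)) z = act A U (lsubmx z).
  by rewrite /act derive_lsubmx row_mxKl.
apply/funext => z; apply/rowP => i; case: (split_ordP i) => [j|s] ->.
  rewrite row_mxEl !mxE -(actl F f) -(actl G g).
  by congr (act _ _ z - act _ _ z); apply/funext => w; rewrite row_mxEl.
rewrite row_mxEr !mxE -(actl F f) -(actl G g).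
by congr (act _ _ z - act _ _ z); apply/funext => w; rewrite row_mxEr.
Qed.

Lemma hormander_lsubmx :
  hormander (orthant_x R n k) (D0_hat Q lambda) (D_tilde lambda) ->
  hormander (orthant R n) (D0J Q lambda) (D_ lambda).
Proof.
move=> hor p p0 v.
have := hor (row_mx p 0); rewrite /orthant_x /= row_mxKl => /(_ p0 (row_mx v 0)).
move=> [X XP vX]; exists (map lsubmx X).
  move=> _ /mapP[_ /XP[H /iter_brackets_tilde_lsubmx[G [h [iG ->]]] <-] ->].
  by exists G; rewrite ?row_mxKl.
(* A linear map sends the span of [X] to the span of its image. *)
pose f := linfun (lsubmx : 'rV[R]_(n + k) -> 'rV[R]_n).
have -> : v = f (row_mx v 0) by rewrite lfunE /= row_mxKl.
have := memv_img f vX; rewrite limg_span.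
by rewrite (eq_map (g := lsubmx)) // => x; rewrite lfunE.
Qed.

Lemma hormander_of_TJ_free (s : 'I_n -> seq {ffun 'I_k -> nat})
    (c : 'I_n -> {ffun 'I_k -> nat} -> R) :
  (forall i alpha, alpha \in s i -> (1 <= \sum_r alpha r)%N) ->
  (forall phi, orthant R n phi ->
     free [tuple TJ Q lambda (s i) (c i) phi | i < n]) ->
  hormander (orthant_x R n k) (D0_hat Q lambda) (D_tilde lambda).
Proof.
move=> s_gt0 TJ_free z z0 v.
pose X := [seq D_tilde lambda r z | r <- enum 'I_k] ++
  flatten [seq [seq ad_multi (D_tilde lambda) al (D0_hat Q lambda) z | al <- s i]
          | i <- enum 'I_n].
have XD r : D_tilde lambda r z \in <<X>>%VS.
  by apply: memv_span; rewrite mem_cat; apply/orP; left; apply: map_f; rewrite mem_enum.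
exists X.
  move=> x; rewrite mem_cat => /orP[/mapP[r _ ->]|].
    by exists (D_tilde lambda r) => //; apply: ib_gen; right; exists r.
  move=> /flatten_mapP[i _ /mapP[al _ ->]].
  exists (ad_multi (D_tilde lambda) al (D0_hat Q lambda)) => //.
  by apply: iter_brackets_ad_multi; [move=> r; right; exists r|left].
set p := lsubmx z.
have XDsum (w : 'I_k -> R) : \sum_r w r *: D_tilde lambda r z \in <<X>>%VS.
  by apply: memv_suml => r _; apply: memvZ.
have Dsum (w : 'I_k -> R) : \sum_r w r *: D_tilde lambda r z =
    row_mx (\sum_r w r *: D_ lambda r p) (\row_r w r).
  apply/rowP => i; rewrite summxE; case: (split_ordP i) => [j|t] ->.
    by rewrite row_mxEl summxE; apply: eq_bigr => r _; rewrite [LHS]mxE row_mxEl [RHS]mxE.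
  rewrite row_mxEr mxE (bigD1 t) //= big1 => [|r rt].
    by rewrite mxE row_mxEr mxE !eqxx mulr1 addr0.
  by rewrite mxE row_mxEr mxE eqxx eq_sym (negbTE rt) mulr0.
have Xad i al : al \in s i ->
    row_mx (ad_multi (D_ lambda) al (J Q) p) 0 \in <<X>>%VS.
  move=> als.
  have [d [g [d0 _ _ /(_ z z0) adE]]] :=
    lifts_ad_multi lifts_D0_hat (s_gt0 _ _ als).
  (* The flag [true] gives [d = 0], so removing the [D_tilde] combination clears the x-part and
     leaves the bracket of [J Q]. *)
  have -> : row_mx (ad_multi (D_ lambda) al (J Q) p) 0 =
      ad_multi (D_tilde lambda) al (D0_hat Q lambda) z
      - \sum_r g r p *: D_tilde lambda r z.
    rewrite adE Dsum opp_row_mx add_row_mx subrr -/p.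
    rewrite [\row_j (d j * _)](_ : _ = 0) ?addr0 ?addrK //.
    by apply/rowP => j; rewrite !mxE d0 ?mul0r.
  apply: memvB; last exact: XDsum.
  apply: memv_span; rewrite mem_cat; apply/orP; right.
  by apply/flatten_mapP; exists i; [rewrite mem_enum|apply: map_f].
have Xrow u : row_mx u 0 \in <<X>>%VS.
  pose f := linfun (mulmxr (row_mx 1%:M 0) : 'rV[R]_n -> 'rV[R]_(n + k)).
  have fE w : f w = row_mx w 0 by rewrite lfunE /= mul_mx_row mulmx1 mulmx0.
  rewrite -fE.
  (* Here n free vectors in dimension n form a basis. *)
  have Tb : basis_of fullv [tuple TJ Q lambda (s i) (c i) p | i < n].
    by rewrite basisEfree (TJ_free _ z0) subvf size_tuple dimvf dim_matrix mul1r /=.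
  rewrite (coord_basis Tb (memvf u)) linear_sum; apply: memv_suml => i _.
  rewrite linearZ; apply: memvZ.
  rewrite -(tnth_nth 0) tnth_mktuple /TJ linear_sum big_seq.
  by apply: memv_suml => al als; rewrite linearZ memvZ //= fE; apply: Xad als.
(* The [D_tilde] combination is chosen to match the x-part of [v]; the remainder has zero x-part. *)
have -> : v = row_mx (lsubmx v - \sum_r rsubmx v 0 r *: D_ lambda r p) 0
    + \sum_r rsubmx v 0 r *: D_tilde lambda r z.
  rewrite Dsum add_row_mx subrK add0r -[LHS]hsubmxK; congr row_mx.
  by apply/rowP => r; rewrite [RHS]mxE.
by apply: memvD.
Qed.

End Model.

Unset Implicit Arguments.
Set Strict Implicit.

Theorem proposition5p3 (R : realType) (n k : nat)
  (k_ge1 : (1 <= k)%N) (k_lt_n : (k < n)%N)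
  (Q : 'M[R]_n.+1)
  (Q_offdiag : forall i j, i != j -> 0 <= Q i j)
  (Q_diag : forall i, Q i i <= 0)
  (Q_rows : forall i, \sum_j Q i j = 0)
  (lambda : 'I_n.+1 -> 'rV[R]_k)
  (lambda_inj : injective lambda)
  (lambda0_vertex : extreme_point (convex_hull lambda) (lambda ord0)) :
  (hormander (orthant_x R n k) (D0_hat Q lambda) (D_tilde lambda) ->
   hormander (orthant R n) (D0J Q lambda) (D_ lambda))
  /\
  (hormander (orthant R n) (D0J Q lambda) (D_ lambda) ->
   (exists (s : 'I_n -> seq {ffun 'I_k -> nat})
           (c : 'I_n -> {ffun 'I_k -> nat} -> R),
      [/\ forall i, uniq (s i),
          forall i alpha, alpha \in s i -> (1 <= \sum_r alpha r)%N
        & forall phi, orthant R n phi ->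
            free [tuple TJ Q lambda (s i) (c i) phi | i < n]]) ->
   hormander (orthant_x R n k) (D0_hat Q lambda) (D_tilde lambda)).
Proof.
split; first exact: hormander_lsubmx.
by move=> _ [s [c [_ s_gt0 TJ_free]]]; apply: hormander_of_TJ_free s_gt0 TJ_free.
Qed.
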